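(* There exists a function $f:\mathbb{N}\to\mathbb{N}$ such that for every finite group $G$, if $G/Z(G)$ has rank $r$, then the derived group $G'$ has rank at most $f(r)$. (That is, the rank of $G'$ is $r$-bounded.)
   Context: A group $K$ has finite rank $r$ if every finitely generated subgroup of $K$ can be generated by at most $r$ elements; $r(K)$, the rank of $K$, denotes the least such $r$. $Z(G)$ denotes the center of $G$ and $G'$ its derived (commutator) subgroup. A quantity is ''$r$-bounded'' if it is bounded by a number depending only on $r$. Here $\mathbb{N}$ includes $0$. *)

(* Defs.v *)
From mathcomp Require Import all_boot all_fingroup all_solvable.

Set Implicit Arguments.
Unset Strict Implicit.
Unset Printing Implicit Defensive.

Import GroupScope.

(* This is the Pruefer rank, not MathComp's 'r(K), which is the largest rank
   of an elementary abelian subgroup. In a finite group every subgroup is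
   finitely generated; 'm(H) is the least size of a generating set of H. *)
Definition has_rank (gT : finGroupType) (K : {set gT}) (r : nat) : bool :=
  [forall (H : {group gT} | H \subset K), 'm(H) <= r].

Lemma ex_has_rank (gT : finGroupType) (K : {set gT}) : exists r, has_rank K r.
Proof.
exists #|gT|; apply/forallP=> H; apply/implyP=> _.
by rewrite -{1}(genGid H) (leq_trans (grank_min H)) ?max_card.
Qed.

Definition prank (gT : finGroupType) (K : {set gT}) : nat :=
  ex_minn (ex_has_rank K).

(* Main.v *)
(* A subgroup H of G' needs at most r + 'm(H :&: 'Z(G)) generators, and the
   second term is the rank of an elementary abelian p-subgroup E of 'Z(G).
   Transfer places E inside P', for P a Sylow p-subgroup, so one has to bound
   #|E| when E <= P' is elementary abelian and P / Z has rank r, Z central.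
   Let V be the (2r + 2)-th term of the Frattini series of P. A descent on the
   order shows [N, V] <= Mho (Mho N) for every normal N <= V; so W := V' is
   powerful, in a sense that does not single out p = 2, and its elementary
   abelian subgroups have order at most #|W : Mho W| <= p ^ (r ^ 2). Since
   V * Z has r-bounded p-index in P, climbing from it to P through maximal
   subgroups, each step enlarging the elementary part of the derived subgroup
   by a factor of at most p ^ r, bounds #|E|. *)

Require Import Defs.
From mathcomp Require Import all_boot all_fingroup all_solvable.
From mathcomp Require Import ssralg finalg.

Import GroupScope.

Set Implicit Arguments.
Unset Strict Implicit.
Unset Printing Implicit Defensive.

(** * Power subgroups and a strong form of powerfulness *)

Lemma mem_Mho1 (gT : finGroupType) (p : nat) (G : {group gT}) x :
  p.-group G -> x \in G -> x ^+ p \in 'Mho^1(G).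
Proof. by move=> pG Gx; apply: (Mho_p_elt 1 Gx (mem_p_elt pG Gx)). Qed.

Lemma Mho1_sub (gT : finGroupType) (p : nat) (G K : {group gT}) :
  p.-group G -> {in G, forall x, x ^+ p \in K} -> 'Mho^1(G) \subset K.
Proof.
move=> pG sGK; rewrite (MhoE 1 pG) gen_subG.
by apply/subsetP=> _ /imsetP[x Gx ->]; apply: sGK.
Qed.

(** In the nilpotent group [G / K] a nontrivial normal subgroup properly contains its commutator
    with the whole group. Inclusions may thus be checked modulo one further commutator. *)
Lemma sub_joing_commg (gT : finGroupType) (p : nat)
    (G L K : {group gT}) :
    p.-group G -> L <| G -> K <| G -> L \subset K <*> [~: L, G] ->
  L \subset K.
Proof.
move=> pG /andP[sLG nLG] /andP[sKG nKG] sLK.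
have nKL := subset_trans sLG nKG.
rewrite -quotient_sub1 //; apply/trivgP/eqP/idPn=> ntL.
have nilG : nilpotent (G / K) := pgroup_nil (quotient_pgroup K pG).
have nLG' : G / K \subset 'N_(G / K)(L / K).
  by rewrite subsetI subxx quotient_norms.
have := nil_comm_properl nilG (quotientS K sLG) ntL nLG'.
rewrite -quotientR // properE => /andP[_ /negP[]].
apply: subset_trans (quotientS K sLK) _.
by rewrite quotientYidl // comm_subG.
Qed.

Section MhoCommutator.

Variables (gT : finGroupType) (p : nat) (G : {group gT}).
Hypotheses (pG : p.-group G) (powG : G^`(1) \subset 'Mho^1('Mho^1(G))).

Let M1 := 'Mho^1(G).
Let M2 := 'Mho^1('Mho^1(G)).
Let M3 := 'Mho^1('Mho^1('Mho^1(G))).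

(** When [x, g] is central, [x ^ p, g] = [x, g] ^ p, which is trivial because G' lies in [M2] and
    [M3] is trivial. A first pass, on [M1], makes [M2] central; then G' is central and a second
    pass, on [G], applies. *)
Lemma Mho1_central :
  M3 = 1 -> [~: M1, G] \subset 'Z(G) -> M1 \subset 'Z(G).
Proof.
move=> M3_1 cM1.
have sM1G : M1 \subset G := Mho_sub 1 G.
have pM1 : p.-group M1 := pgroupS sM1G pG.
have pM2 : p.-group M2 := pgroupS (Mho_sub 1 _) pM1.
have comXp x g : x \in G -> g \in G -> [~ x, g] ^+ p = 1.
  move=> Gx Gg; apply/set1P; rewrite -[[set 1]]M3_1.
  by apply: (mem_Mho1 pM2); rewrite (subsetP powG) ?mem_commg.
have powcent (A : {group gT}) : A \subset G -> 
    (forall x g, x \in A -> g \in G -> [~ x, g] \in 'Z(G)) ->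
  'Mho^1(A) \subset 'Z(G).
  move=> sAG cAG; apply: (Mho1_sub (pgroupS sAG pG)) => x Ax.
  have Gx := subsetP sAG x Ax.
  rewrite inE groupX //; apply/centP=> g Gg; apply/commgP.
  rewrite commXg ?comXp //.
  by have /centerP[_ cRG] := cAG x g Ax Gg; apply/commute_sym/cRG.
have cM2 : M2 \subset 'Z(G).
  by apply: powcent => // x g M1x Gg; rewrite (subsetP cM1) ?mem_commg.
apply: powcent => // x g Gx Gg.
by rewrite (subsetP cM2) // (subsetP powG) ?mem_commg.
Qed.

End MhoCommutator.

(** By [sub_joing_commg] one may also factor out [M1, G, G], and then [Mho1_central] applies. The
    conclusion passes the hypothesis on [G] down to [M1]. *)
Lemma commg_Mho1_sub (gT : finGroupType) (p : nat) (G : {group gT}) :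
    p.-group G -> G^`(1) \subset 'Mho^1('Mho^1(G)) ->
  [~: 'Mho^1(G), G] \subset 'Mho^1('Mho^1('Mho^1(G))).
Proof.
move=> pG powG.
set M1 := 'Mho^1(G); set M3 := 'Mho^1('Mho^1('Mho^1(G))).
have chM1 : M1 \char G := Mho_char 1 G.
have chM3 : M3 \char G by rewrite !gFchar_trans.
have nsRG : [~: M1, G] <| G by rewrite char_normal ?charR ?char_refl.
have chK : M3 <*> [~: [~: M1, G], G] \char G by rewrite charY ?charR ?char_refl.
apply: (sub_joing_commg pG nsRG (char_normal chM3)).
set K := (_ <*> _) in chK *.
have nKG := char_norm chK.
have nKM1 : M1 \subset 'N(K) by rewrite (subset_trans (char_sub chM1)).
rewrite -quotient_cents2 // /M1 /quotient morphim_Mho // -!quotientE.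
apply: subset_trans (subsetIr (G / K) _).
apply: (Mho1_central (quotient_pgroup K pG)).
- rewrite -quotient_der // /quotient -!morphim_Mho ?(subset_trans (Mho_sub _ _)) //.
  exact: morphimS.
- rewrite /quotient -!morphim_Mho ?(subset_trans (Mho_sub _ _)) ?(subset_trans (Mho_sub _ _)) //.
  by apply/trivgP; rewrite quotient_sub1 ?joing_subl // (subset_trans (char_sub chM3)).
rewrite subsetI; apply/andP; split.
  by rewrite comm_subG ?Mho_sub.
rewrite /quotient -morphim_Mho // -morphimR ?(subset_trans (Mho_sub _ _)) //.
rewrite -!quotientE quotient_cents2 ?joing_subr //.
by rewrite comm_subG // ?(subset_trans (char_sub chM1)).
Qed.

(* The p-th power map makes G / Mho G cover Mho G / Mho (Mho G); its kernel
   contains the image of E. *)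
Lemma card_abelem_le_Mho_index (gT : finGroupType) (p : nat) (G E : {group gT}) :
    p.-group G -> G^`(1) \subset 'Mho^1('Mho^1(G)) ->
    E \subset G -> p.-abelem E ->
  #|E| <= #|G : 'Mho^1(G)|.
Proof.
have [n] := ubnP #|G|; elim: n G E => // n IHn G E.
move=> /ltnSE-leGn pG powG sEG abelE.
have [G1 | ntG] := eqVneq G 1%G.
  by move: sEG; rewrite G1 => /trivgP->; rewrite cards1 indexg_gt0.
set M1 := 'Mho^1(G)%G; set M2 := 'Mho^1(M1)%G.
have sM1G : M1 \subset G := Mho_sub 1 G.
have sM2M1 : M2 \subset M1 := Mho_sub 1 M1.
have sM2G := subset_trans sM2M1 sM1G.
have nsM2G : M2 <| G by rewrite !gFnormal_trans.
have nM2G := normal_norm nsM2G.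
have nsM1G : M1 <| G := Mho_normal 1 G.
have ltM1n : #|M1| < n.
  apply: leq_trans leGn; apply/proper_card.
  apply: sub_proper_trans (Phi_proper ntG).
  by rewrite (Phi_joing pG) joing_subr.
have pM1 := pgroupS sM1G pG.
have powM1 : M1^`(1) \subset 'Mho^1('Mho^1(M1)).
  by apply: subset_trans (commg_Mho1_sub pG powG); rewrite commgS.
have leEM1 : #|E :&: M1| <= #|M1 : M2|.
  by apply: (IHn M1 (E :&: M1)%G); rewrite ?subsetIr // (abelemS (subsetIl _ _)).
have cGM2 : abelian (G / M2) := sub_der1_abelian powG.
have pGM2 := quotient_pgroup M2 pG.
have sOhm (A : {group gT}) : A \subset G -> 'Mho^1(A) \subset M2 ->
    A / M2 \subset 'Ohm_1(G / M2).
  move=> sAG sA; rewrite (OhmE 1 pGM2).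
  apply: subset_trans (subset_gen _).
  apply/subsetP=> _ /morphimP[x nx Ax ->]; rewrite !inE mem_quotient ?(subsetP sAG) //=.
  rewrite -morphX //=; apply/eqP/coset_id/(subsetP sA).
  exact: mem_Mho1 (pgroupS sAG pG) Ax.
have sEM1 : (E <*> M1) / M2 \subset 'Ohm_1(G / M2).
  rewrite quotientY ?(subset_trans _ nM2G) // join_subG !sOhm //.
  apply: (Mho1_sub (abelem_pgroup abelE)) => x Ex.
  by case/and3P: abelE => _ _ /exponentP->.
(* In the abelian group [G / M2] the order of the kernel of the [p]-th power map is the index of its
   image [M1 / M2]. *)
have oOhm : #|'Ohm_1(G / M2)| = #|G : M1|.
  have := mul_card_Ohm_Mho_abelian 1 cGM2.
  rewrite -[in 'Mho^1(_)]/(_ @* G) -morphim_Mho // -quotientE.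
  rewrite -(Lagrange (quotientS M2 sM1G)) mulnC => /eqP.
  by rewrite eqn_pmul2l ?cardG_gt0 // index_quotient_eq ?subIset ?sM2M1 ?orbT // => /eqP.
have nM1E := subset_trans sEG (normal_norm nsM1G).
(* Here |E M1 : M2| = |E : E ∩ M1| |M1 : M2|, and induction bounds |E ∩ M1| by the second factor. *)
rewrite -oOhm; apply: leq_trans (subset_leq_card sEM1).
rewrite card_quotient ?(subset_trans _ nM2G) ?join_subG ?sEG //.
rewrite -(Lagrange_index (joing_subr E M1) sM2M1).
rewrite -(LagrangeI E M1) mulnC.
rewrite (_ : #|E <*> M1 : M1| = #|E : M1|) ?leq_mul2r ?leq_mul2l ?leEM1 ?orbT //.
by rewrite joingC norm_joinEr // indexMg.
Qed.

(** * Generator counts and rank modulo a central subgroup *)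

Lemma grank_lift (gT : finGroupType) (H Z : {group gT}) :
    H \subset 'N(Z) ->
  exists B : {set gT},
    [/\ B \subset H, #|B| <= 'm(H / Z) & B <*> (H :&: Z) = H].
Proof.
move=> nZH; have [C genC cardC] := grank_witness (H / Z).
have HZ_C y : y \in C -> exists2 x, x \in H & y = coset Z x.
  move=> Cy; have: y \in H / Z by rewrite -genC mem_gen.
  by case/morphimP=> x _ Hx ->; exists x.
(* [Z] need not lie in [H], so the representative is taken in [H :&: y]. *)
pose g (y : coset_of Z) := repr (H :&: y).
have gP y : y \in C -> g y \in H /\ coset Z (g y) = y.
  move=> Cy; have [x Hx def_y] := HZ_C y Cy.
  have Nx := subsetP nZH x Hx.
  have: g y \in H :&: y.
    by apply: (mem_repr x); rewrite inE Hx def_y val_coset // rcoset_refl.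
  by case/setIP=> Hg; move/coset_mem.
exists (g @: C); have sBH : g @: C \subset H.
  by apply/subsetP=> _ /imsetP[y Cy ->]; have [] := gP y Cy.
split=> //; first by rewrite -cardC leq_imset_card.
apply/eqP; rewrite eqEsubset join_subG sBH subsetIl /=.
have sHZB : H \subset Z * <<g @: C>>.
  rewrite -quotientSK // -genC gen_subG.
  apply/subsetP=> y Cy; have [Hg <-] := gP y Cy.
  by rewrite mem_quotient // mem_gen // imset_f.
apply/subsetP=> x Hx; have /mulsgP[z b Zz Bb def_x] := subsetP sHZB x Hx.
have Hb : b \in H by apply: subsetP Bb; rewrite gen_subG.
have Hz : z \in H by rewrite -(groupMr _ Hb) -def_x.
rewrite def_x groupM ?(subsetP (genS (subsetUl _ _)) _ Bb) //.
by rewrite mem_gen // inE orbC inE Hz Zz.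
Qed.

(** On [H] the map factors through the quotient by [H :&: Z], so the images of lifted generators
    suffice. This bounds the images of commutator maps, which kill a central [Z]. *)
Lemma morphim_grank_factor (aT rT : finGroupType) (D H Z : {group aT})
    (f : {morphism D >-> rT}) :
    H \subset D -> H \subset 'N(Z) -> H :&: Z \subset 'ker f ->
  'm(f @* H) <= 'm(H / Z).
Proof.
move=> sHD nZH kZ; have [B [sBH cardB defH]] := grank_lift nZH.
have sBD := subset_trans sBH sHD.
have -> : f @* H = <<f @* B>>.
  rewrite -{1}defH morphimY ?subIset ?sHD //.
  have kf : f @* (H :&: Z) = 1.
    by apply/trivgP; rewrite -(morphim_ker f) morphimS.
  by rewrite kf -joing_idl joingG1.
apply: leq_trans (grank_min _) _; apply: leq_trans cardB.
by rewrite /morphim; apply: leq_trans (leq_imset_card _ _) (subset_leq_card (subsetIr _ _)).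
Qed.

Lemma grank_extension (gT : finGroupType) (H Z : {group gT}) :
  H \subset 'N(Z) -> 'm(H) <= 'm(H / Z) + 'm(H :&: Z).
Proof.
move=> nZH; have [B [sBH cardB defH]] := grank_lift nZH.
have [C genC cardC] := grank_witness (H :&: Z).
rewrite -{1}defH -{1}genC joing_idr; apply: leq_trans (grank_min _) _.
by apply: leq_trans (leq_card_setU _ _) (leq_add cardB _); rewrite cardC.
Qed.

(* The rank is that of G / Z; Z is tested on subgroups that need not contain
   it, as H / Z is then (H * Z) / Z. *)
Definition central_rank_le (gT : finGroupType) (r : nat) (G Z : {group gT}) : Prop :=
  Z \subset 'Z(G) /\ forall H : {group gT}, H \subset G -> 'm(H / Z) <= r.

Section Crank.

Variables (gT : finGroupType) (r : nat) (G Z : {group gT}).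
Hypothesis crG : central_rank_le r G Z.

Lemma central_rank_le_normal : Z <| G.
Proof. by case: crG => /sub_center_normal. Qed.

Lemma central_rank_le_norm (H : {group gT}) : H \subset G -> H \subset 'N(Z).
Proof. by move=> sHG; rewrite (subset_trans sHG) ?normal_norm ?central_rank_le_normal. Qed.

Lemma central_rank_le_sub (H : {group gT}) : H \subset G -> Z \subset H -> central_rank_le r H Z.
Proof.
move=> sHG sZH; have [cZ rk] := crG; split=> [|K sKH].
  rewrite subsetI sZH; move: cZ; rewrite subsetI => /andP[_ cZ].
  by rewrite (subset_trans cZ) ?centS.
by rewrite rk ?(subset_trans sKH).
Qed.

Lemma central_rank_le_quotient (K : {group gT}) : K <| G -> central_rank_le r (G / K) (Z / K).
Proof.
move=> nsKG; have [cZ rk] := crG; have nKG := normal_norm nsKG; split.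
  by apply: subset_trans (quotientS K cZ) _; apply: morphim_center.
move=> _ /(inv_quotientS nsKG)[H -> sKH sHG] /=.
have nKH := subset_trans sHG nKG.
have nZH := central_rank_le_norm sHG.
have nZKH : H / K \subset 'N(Z / K) := quotient_norms K nZH.
have sHD : H \subset coset K @*^-1 'N(Z / K) by rewrite -sub_quotient_pre.
have -> : H / K / (Z / K) = (coset (Z / K) \o coset K) @* H.
  by rewrite morphim_comp.
apply: leq_trans (rk H sHG); apply: morphim_grank_factor => //.
apply/subsetP=> z /setIP[Hz Zz]; apply/kerP; first exact: (subsetP sHD).
by rewrite /= coset_id // mem_quotient.
Qed.

End Crank.

(** * The Frattini series and what it centralises *)

(** Commutation with a fixed element of [M] is a homomorphism on [D] with central values, so [p]-th
    powers land in ['Mho^1(L)]; D' centralises [M] by the three subgroups lemma. One Frattini step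
    thus replaces [L] by ['Mho^1(L)]. *)
Lemma commg_Phi_sub (gT : finGroupType) (p : nat) (G D M L : {group gT}) :
    p.-group G -> D \subset G -> M \subset G -> L \subset 'Z(G) ->
    [~: D, M] \subset L ->
  [~: 'Phi(D), M] \subset 'Mho^1(L).
Proof.
move=> pG sDG sMG cL sDML.
have pD := pgroupS sDG pG.
have pL : p.-group L := pgroupS (subset_trans cL (center_sub G)) pG.
have cR x y : x \in D -> y \in M -> [~ x, y] \in 'Z(G).
  by move=> Dx My; rewrite (subsetP cL) // (subsetP sDML) ?mem_commg.
have cDM : [~: D, M] \subset 'C(G).
  by rewrite (subset_trans sDML) // (subset_trans cL) ?subsetIr.
have cD' : D^`(1) \subset 'C(M).
  apply/commG1P/three_subgroup; apply/commG1P; last first.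
    by rewrite commGC; apply: subset_trans cDM _; rewrite centS.
  exact: subset_trans cDM (centS sDG).
have sXL : {in D & M, forall x y, [~ x ^+ p, y] \in 'Mho^1(L)}.
  move=> x y Dx My; have Gx := subsetP sDG x Dx.
  rewrite commXg; last first.
    by have /centerP[_ cxy] := cR x y Dx My; apply/commute_sym/cxy.
  by apply: mem_Mho1 => //; rewrite (subsetP sDML) ?mem_commg.
have nsL : 'Mho^1(L) <| G.
  by apply: sub_center_normal; apply: subset_trans (Mho_sub _ _) cL.
have nLG := normal_norm nsL; have nLD := subset_trans sDG nLG.
have nLM := subset_trans sMG nLG.
rewrite -quotient_cents2 ?(subset_trans (Phi_sub D)) //.
rewrite (Phi_joing pD) quotientY ?(subset_trans (der_sub _ _)) ?(subset_trans (Mho_sub _ _)) //.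
rewrite join_subG quotient_cents //=.
have nLMho := subset_trans (Mho_sub 1 D) nLD.
rewrite sub_quotient_pre //.
apply: (Mho1_sub (K := (coset _ @*^-1 'C(M / 'Mho^1(L)))%G) pD) => x Dx.
have Nx : x ^+ p \in 'N('Mho^1(L)) by rewrite groupX // (subsetP nLD).
rewrite mem_morphpre //; apply/centP=> _ /morphimP[y Ny My ->].
apply/commgP; rewrite -morphR //= coset_id ?sXL //.
Qed.

Definition frat (gT : finGroupType) (k : nat) (G : {group gT}) : {group gT} :=
  iter k (fun H : {group gT} => 'Phi(H)%G) G.

Lemma frat_char (gT : finGroupType) k (G : {group gT}) : frat k G \char G.
Proof. by elim: k => [|k IHk] /=; rewrite ?char_refl ?(char_trans (Phi_char _)). Qed.

Lemma quotient_frat (gT : finGroupType) (p k : nat) (G K : {group gT}) :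
  p.-group G -> G \subset 'N(K) -> frat k G / K = frat k (G / K).
Proof.
move=> pG nKG; elim: k => [|k IHk] //=.
have sFG := char_sub (frat_char k G).
rewrite (quotient_Phi (pgroupS sFG pG)) ?(subset_trans sFG) //.
by congr 'Phi(_); exact: IHk.
Qed.

(** Factor out a central subgroup of order [p] inside [M]: by induction the commutator of [frat k G]
    and [M] falls into it, and one more Frattini step reaches its trivial ['Mho^1]. *)
Lemma frat_cent (gT : finGroupType) (p k : nat) (G M : {group gT}) :
    p.-group G -> M <| G -> #|M| <= p ^ k ->
  frat k G \subset 'C(M).
Proof.
elim: k gT G M => [|k IHk] gT G M pG nsMG leM.
  by rewrite (card_le1_trivg leM) cents1.
have [-> | ntM] := eqVneq M 1%G; first by rewrite cents1.
have [sMG nMG] := andP nsMG.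
have ntMZ := meet_center_nil (pgroup_nil pG) nsMG ntM.
have pMZ : p.-group (M :&: 'Z(G)).
  by apply: pgroupS pG; rewrite subIset ?sMG.
have [p_pr p_dv _] := pgroup_pdiv pMZ ntMZ.
have [x /setIP[Mx Zx] ox] := Cauchy p_pr p_dv.
have cL : <[x]> \subset 'Z(G) by rewrite cycle_subG.
have nLG := normal_norm (sub_center_normal cL).
have nLM := subset_trans sMG nLG.
have sFG := char_sub (frat_char k G).
have leML : #|M / <[x]>| <= p ^ k.
  rewrite card_quotient // -divgS ?cycle_subG // -[#|<[x]>|]/#[x] ox.
  by rewrite leq_divLR ?prime_gt0 // -?expnSr // -ox cardSg ?cycle_subG.
have := IHk _ _ _ (quotient_pgroup <[x]> pG) (quotient_normal _ nsMG) leML.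
rewrite -(quotient_frat _ pG nLG) quotient_cents2 ?(subset_trans sFG) // => sRL.
apply/commG1P/trivgP.
apply: subset_trans (commg_Phi_sub pG sFG sMG cL sRL) _.
by rewrite (Mho_p_cycle 1 (mem_p_elt pG (subsetP sMG x Mx))) expn1 -ox expg_order cycle1.
Qed.

(** * Indices of Frattini terms, and the descent on normal subgroups *)

Lemma index_Phi (gT : finGroupType) (p : nat) (G : {group gT}) :
  prime p -> p.-group G -> #|G : 'Phi(G)| <= p ^ 'm(G).
Proof.
move=> p_pr pG; have nPhi := gFnorm Frattini_gFun G.
have abelQ := Phi_quotient_abelem pG.
rewrite -card_quotient // (card_pgroup (abelem_pgroup abelQ)).
rewrite leq_pexp2l ?prime_gt0 // -(rank_abelem abelQ).
by rewrite -grank_abelian ?(abelem_abelian abelQ) // quotient_grank.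
Qed.

Lemma index_frat (gT : finGroupType) (p r k : nat) (G : {group gT}) :
    prime p -> p.-group G ->
    (forall H : {group gT}, H \subset G -> 'm(H) <= r) ->
  #|G : frat k G| <= p ^ (r * k).
Proof.
move=> p_pr pG rkG; elim: k => [|k IHk]; first by rewrite indexgg muln0.
have sFG := char_sub (frat_char k G).
rewrite -(Lagrange_index sFG (Phi_sub _)) mulnS addnC expnD leq_mul //.
apply: leq_trans (index_Phi p_pr (pgroupS sFG pG)) _.
by rewrite leq_pexp2l ?prime_gt0 ?rkG.
Qed.

Lemma central_rank_le_index_frat (gT : finGroupType) (p r k : nat) (G Z H : {group gT}) :
    prime p -> p.-group G -> central_rank_le r G Z -> H \subset G ->
  #|H / Z : frat k H / Z| <= p ^ (r * k).
Proof.
move=> p_pr pG crG sHG; have nZH := central_rank_le_norm crG sHG.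
have pH := pgroupS sHG pG; rewrite (quotient_frat k pH nZH).
apply: index_frat => // [|K sKH]; first exact: quotient_pgroup.
have /(inv_quotientS (central_rank_le_normal crG)) := subset_trans sKH (quotientS Z sHG).
by case=> K' -> _ sK'G; have [_ ->] := crG.
Qed.

Lemma central_rank_le_index (gT : finGroupType) (p r k : nat) (G Z H N : {group gT}) :
    prime p -> p.-group G -> central_rank_le r G Z -> H \subset G -> Z \subset N ->
    frat k H \subset N -> N \subset H ->
  #|H : N| <= p ^ (r * k).
Proof.
move=> p_pr pG crG sHG sZN sFN sNH; have nZH := central_rank_le_norm crG sHG.
rewrite -(index_quotient_eq _ sNH nZH) ?subIset ?sZN ?orbT //.
apply: leq_trans (central_rank_le_index_frat k p_pr pG crG sHG).
by rewrite dvdn_leq ?indexg_gt0 // indexgS ?quotientS.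
Qed.

(* A normal subgroup M of index p in N is central, so N is abelian of exponent
   dividing p ^ 2. Then N / Z has order at most p ^ (2r), so that frat (2r) G
   centralises it, and two more Frattini steps kill the exponent p ^ 2. *)
Lemma frat_cent_Mho1 (gT : finGroupType) (p r : nat) (G Z N : {group gT}) :
    prime p -> p.-group G -> central_rank_le r G Z -> N <| G ->
    N \subset frat (r * 2).+2 G ->
    (forall M : {group gT}, M <| G -> M \proper N ->
       M \subset 'C(frat (r * 2).+2 G)) ->
    'Mho^1('Mho^1(N)) = 1 ->
  N \subset 'C(frat (r * 2).+2 G).
Proof.
move=> p_pr pG crG nsNG sNV cV Mho2N.
have [-> | ntN] := eqVneq N 1%G; first by rewrite sub1G.
have [sNG nNG] := andP nsNG.
have pN := pgroupS sNG pG.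
have cNN : abelian N.
  have [] := normal_pgroup pG nsNG (leq_pred _).
  move=> M [sMN nsMG oM].
  have oN : #|N : M| = p.
    rewrite -divgS // oM (card_pgroup pN).
    have [_ _ [k ->]] := pgroup_pdiv pN ntN; rewrite !pfactorK //=.
    by rewrite expnS mulnK ?expn_gt0 ?prime_gt0.
  have cMV : M \subset 'C(frat (r * 2).+2 G).
    by rewrite cV // properEcard sMN -(Lagrange sMN) oN ltn_Pmulr ?prime_gt1.
  apply: (cyclic_factor_abelian (H := M)).
    by rewrite subsetI sMN (subset_trans cMV) ?centS.
  rewrite prime_cyclic // card_quotient ?oN //.
  by rewrite (subset_trans sNG) ?normal_norm.
have nZN := central_rank_le_norm crG sNG.
(* As [N] is abelian with trivial second ['Mho^1], [frat 2 N] is trivial and its index is the whole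
   order of [N / Z]; this is the source of [r * 2]. *)
have leNZ : #|N / Z| <= p ^ (r * 2).
  have := central_rank_le_index_frat 2 p_pr pG crG sNG.
  rewrite /= (_ : 'Phi('Phi(N)) = 1) ?quotient1 ?indexg1 //.
  by rewrite (Phi_Mho pN cNN) (Phi_Mho (pgroupS (Mho_sub _ _) pN)) ?(abelianS (Mho_sub _ _)).
have nZG := normal_norm (central_rank_le_normal crG).
have := frat_cent (quotient_pgroup Z pG) (quotient_normal Z nsNG) leNZ.
have sFG k := char_sub (frat_char k G).
rewrite -(quotient_frat _ pG nZG) quotient_cents2 ?(subset_trans (sFG _)) // => sFNZ.
pose L := (Z :&: N)%G.
have cL : L \subset 'Z(G) by rewrite subIset //; case: crG => ->.
have sFNL : [~: frat (r * 2) G, N] \subset L.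
  by rewrite subsetI sFNZ commg_subr (subset_trans (sFG _)).
have sL1 := commg_Phi_sub pG (sFG _) sNG cL sFNL.
have := commg_Phi_sub pG (sFG (r * 2).+1) sNG (subset_trans (Mho_sub 1 L) cL) sL1.
move=> /subset_trans/(_ (MhoS 1 (MhoS 1 (subsetIr Z N)))); rewrite Mho2N.
by move=> /trivgP/commG1P; rewrite centsC.
Qed.

(** Modulo the target subgroup, the second ['Mho^1] of [N] is trivial. Induction then shows that
    smaller normal subgroups are centralised, as [frat_cent_Mho1] requires. It ranges over all group
    types because it is applied in a quotient. *)
Lemma comm_frat_Mho (gT : finGroupType) (p r : nat) (G Z N : {group gT}) :
    prime p -> p.-group G -> central_rank_le r G Z -> N <| G ->
    N \subset frat (r * 2).+2 G ->
  [~: N, frat (r * 2).+2 G] \subset 'Mho^1('Mho^1(N)).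
Proof.
have [n] := ubnP #|N|; elim: n gT G Z N => // n IHn gT G Z N.
move=> /ltnSE-leNn p_pr pG crG nsNG sNV.
have [-> | ntN] := eqVneq N 1%G; first by rewrite comm1G sub1G.
pose K := 'Mho^1('Mho^1(N))%G.
have nsKG : K <| G by rewrite !gFnormal_trans.
have nKG := normal_norm nsKG; have [sNG nNG] := andP nsNG.
have nKN := subset_trans sNG nKG.
have sVG := char_sub (frat_char (r * 2).+2 G).
have nKV := subset_trans sVG nKG.
suffices: N / K \subset 'C(frat (r * 2).+2 (G / K)).
  by rewrite -(quotient_frat _ pG nKG) quotient_cents2.
have crGb := central_rank_le_quotient crG nsKG; have pGb := quotient_pgroup K pG.
have sNVb : N / K \subset frat (r * 2).+2 (G / K).
  by rewrite -(quotient_frat _ pG nKG) quotientS.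
have nsNGb := quotient_normal K nsNG.
have leNb : #|N / K| <= n by apply: leq_trans leNn; apply: leq_quotient.
have Mho2N : 'Mho^1('Mho^1(N / K)) = 1.
  rewrite /quotient -!morphim_Mho ?(subset_trans (Mho_sub _ _)) //.
  exact: trivg_quotient.
apply: (frat_cent_Mho1 p_pr pGb crGb) => // M nsMG ltMN.
have sMN := proper_sub ltMN.
have ltMn : #|M| < n by apply: leq_trans (proper_card ltMN) leNb.
have := IHn _ _ _ M ltMn p_pr pGb crGb nsMG (subset_trans sMN sNVb).
move=> /subset_trans/(_ (MhoS 1 (MhoS 1 sMN))); rewrite Mho2N.
by move=> /trivgP/commG1P.
Qed.

(** * Climbing through maximal subgroups *)

(** As [M] is abelian and normal, commutation with [g] is an endomorphism of [M]. Its image is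
    normal in [G], and modulo it [g] commutes with [M], so the quotient is abelian. *)
Lemma der1_abelian_cycle (gT : finGroupType) (G M : {group gT}) (g : gT) :
    M <| G -> abelian M -> g \in G -> M * <[g]> = G ->
  exists2 f : {morphism M >-> gT},
    {in M, forall x, f x = [~ x, g]} & G^`(1) \subset f @* M.
Proof.
move=> /andP[sMG nMG] cMM Gg defG.
have nMg := subsetP nMG g Gg.
have MR x : x \in M -> [~ x, g] \in M.
  by move=> Mx; rewrite commgEl groupM ?groupV // memJ_norm.
have fM : {in M &, {morph (fun x => [~ x, g]) : x y / x * y}}.
  move=> x y Mx My /=; rewrite commMgJ; congr (_ * _).
  by apply/conjg_fixP/commgP; apply: (centsP cMM); rewrite ?MR.
exists (Morphism fM) => //=.
set f := Morphism fM; pose X := (f @* M)%G.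
have sXM : X \subset M by apply/subsetP=> _ /morphimP[x Mx _ ->]; exact: MR.
have nXM : M \subset 'N(X) by rewrite cents_norm // centsC (subset_trans sXM).
have nXg : g \in 'N(X).
  rewrite inE; apply/subsetP=> _ /imsetP[_ /morphimP[x Mx _ ->] ->].
  have Mxg : x ^ g \in M by rewrite memJ_norm.
  apply/morphimP; exists (x ^ g) => //=.
  by rewrite conjRg (conjgE g g) mulKg.
have nXG : G \subset 'N(X) by rewrite -defG mul_subG ?cycle_subG.
apply: (der1_min (H := X)) => //.
rewrite -defG quotientMl // abelianM !quotient_abelian ?cycle_abelian //=.
rewrite quotient_cycle // cycle_subG.
apply/centP=> _ /morphimP[x nXx Mx ->]; apply/commgP.
rewrite -morphR //= -invg_comm coset_id // groupV.
by apply/morphimP; exists x.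
Qed.

(* Modulo M', G' is the image of M under x |-> [~ x, g], which kills Z. *)
Lemma card_abelem_der1_step (gT : finGroupType) (p r : nat)
    (G Z M E : {group gT}) (g : gT) :
    prime p -> p.-group G -> central_rank_le r G Z -> M <| G -> Z \subset M ->
    g \in G -> M * <[g]> = G -> E \subset G -> p.-abelem E ->
  #|E :&: G^`(1)| <= p ^ r * #|E :&: M^`(1)|.
Proof.
move=> p_pr pG crG nsMG sZM Gg defG sEG abelE.
have [sMG nMG] := andP nsMG.
pose K := (M^`(1))%G; have nsKG : K <| G by rewrite gFnormal_trans.
have nKG := normal_norm nsKG; have nKM := subset_trans sMG nKG.
have nKg := subsetP nKG g Gg.
have [f fE sGf] : exists2 f : {morphism (M / K) >-> coset_of K},
    {in M / K, forall x, f x = [~ x, coset K g]} & (G / K)^`(1) \subset f @* (M / K).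
  apply: der1_abelian_cycle; rewrite ?quotient_normal ?der_abelian ?mem_quotient //.
  by rewrite -quotient_cycle // -quotientMl ?defG.
(* Composed with reduction modulo M', [f] kills the central [Z]; its image thus needs no more
   generators than [M / Z]. *)
have rkX : 'm(f @* (M / K)) <= r.
  rewrite /quotient -morphim_comp.
  have [cZ rk] := crG; apply: leq_trans (rk M sMG).
  have sMD : M \subset coset K @*^-1 (M / K).
    by rewrite -sub_quotient_pre.
  apply: morphim_grank_factor (central_rank_le_norm crG sMG) _ => //.
  apply/subsetP=> z /setIP[Mz Zz]; apply/kerP; first exact: (subsetP sMD).
  rewrite /= fE ?mem_quotient // -morphR ?(subsetP nKM z) //=.
  have /setIP[_ /centP cz] := subsetP cZ z Zz.
  by rewrite (_ : [~ z, g] = 1) ?morph1 //; apply/eqP/commgP/cz.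
have abX : abelian (f @* (M / K)) by rewrite morphim_abelian // sub_der1_abelian.
pose A := (E :&: G^`(1))%G; have sAG : A \subset G by rewrite subIset ?sEG.
have abelA : p.-abelem A := abelemS (subsetIl _ _) abelE.
have sAX : A / K \subset f @* (M / K).
  by apply: subset_trans sGf; rewrite -quotient_der // quotientS ?subsetIr.
have oAK : #|A / K| <= p ^ r.
  have abelAK := quotient_abelem K abelA.
  rewrite (card_pgroup (abelem_pgroup abelAK)) leq_pexp2l ?prime_gt0 //.
  by rewrite -(rank_abelem abelAK) (leq_trans (rankS sAX)) // -(grank_abelian abX).
rewrite -[in X in X <= _](LagrangeI A K) mulnC -card_quotient ?(subset_trans sAG) //.
rewrite leq_mul // subset_leq_card //.
by rewrite /= -setIA setIS // subsetIr.
Qed.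

(** Each maximal step on the way from [G] down to [N] has index [p] and costs p ^ r, which is that
    index to the power [r]. *)
Lemma card_abelem_der1_index (gT : finGroupType) (p r : nat)
    (G Z N E : {group gT}) :
    prime p -> p.-group G -> central_rank_le r G Z -> Z \subset N -> N \subset G ->
    E \subset G -> p.-abelem E ->
  #|E :&: G^`(1)| <= #|E :&: N^`(1)| * #|G : N| ^ r.
Proof.
move=> p_pr; have [n] := ubnP #|G|; elim: n G E => // n IHn G E.
move=> /ltnSE-leGn pG crG sZN sNG sEG abelE.
have [-> | [M maxM sNM]] := maximal_exists sNG.
  by rewrite indexgg exp1n muln1.
have nsMG := p_maximal_normal pG maxM; have [sMG nMG] := andP nsMG.
have iMG := p_maximal_index pG maxM.
have ltMG : M \proper G := maxgroupp maxM.
have [_ [g Gg notMg]] := properP ltMG.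
have sZM := subset_trans sZN sNM.
have defG : M * <[g]> = G by rewrite (mulg_normal_maximal nsMG) ?cycle_subG.
apply: leq_trans (card_abelem_der1_step p_pr pG crG nsMG sZM Gg defG sEG abelE) _.
have ltMn : #|M| < n := leq_trans (proper_card ltMG) leGn.
have := IHn M (E :&: M)%G ltMn (pgroupS sMG pG) (central_rank_le_sub crG sMG sZM) sZN sNM
  (subsetIr E M) (abelemS (subsetIl E M) abelE).
rewrite /= -!setIA (setIidPr (der_sub 1 M)).
rewrite (setIidPr (subset_trans (der_sub 1 N) sNM)) => leM.
by rewrite -(Lagrange_index sMG sNM) iMG expnMn mulnCA leq_mul2l leM orbT.
Qed.

(** In the exponent, [r * r] bounds the part of [E] inside [W]; the other term is the exponent
    [r * (r * 2).+2] of the index of [N], times [r] for the climb from [N] to [G]. *)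
Lemma card_abelem_der1 (gT : finGroupType) (p r : nat) (G Z E : {group gT}) :
    prime p -> p.-group G -> central_rank_le r G Z -> E \subset G^`(1) -> p.-abelem E ->
  #|E| <= p ^ (r * r + r * (r * 2).+2 * r).
Proof.
move=> p_pr pG crG sEG' abelE; have sEG := subset_trans sEG' (der_sub 1 G).
have sZG := normal_sub (central_rank_le_normal crG).
have leX m n : m <= n -> m ^ r <= n ^ r.
  by move=> le_mn; case: (posnP r) => [-> // | r_gt0]; rewrite leq_exp2r.
pose V := frat (r * 2).+2 G; pose N := (V <*> Z)%G.
have chV : V \char G := frat_char _ _.
have sVG := char_sub chV.
have sNG : N \subset G by rewrite join_subG sVG.
have leGN : #|G : N| <= p ^ (r * (r * 2).+2).
  by apply: (central_rank_le_index p_pr pG crG); rewrite ?joing_subl ?joing_subr.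
have cZG : Z \subset 'C(G) by case: crG; rewrite subsetI => /andP[].
pose W := (V^`(1))%G.
have cZV : Z \subset 'C(V) := subset_trans cZG (centS sVG).
have defW : N^`(1) = W.
  have cZZ : abelian Z := subset_trans cZG (centS sZG).
  have := der_cprod 1 (cprodEY cZV).
  by rewrite (derG1P cZZ) cprodg1 => /esym.
have sWV : W \subset V := der_sub 1 V.
have nsWG : W <| G by rewrite gFnormal_trans ?char_normal.
have sWG := normal_sub nsWG.
have pW := pgroupS sWG pG.
have sWV2 := comm_frat_Mho p_pr pG crG nsWG sWV.
have powW : W^`(1) \subset 'Mho^1('Mho^1(W)).
  by apply: subset_trans sWV2; rewrite commgS.
have leEW : #|E :&: W| <= #|W : 'Mho^1(W)|.
  apply: (card_abelem_le_Mho_index (E := (E :&: W)%G) pW powW).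
    exact: subsetIr.
  exact: abelemS (subsetIl _ _) abelE.
(* Modulo ['Mho^1(W)] the derived subgroup of [N] becomes elementary abelian and central. The climb
   then starts from the abelian centre of [B], which contains ['Phi(B)] and so has index at most p ^
   r. *)
have leW : #|W : 'Mho^1(W)| <= p ^ (r * r).
  pose K := 'Mho^1(W)%G; have nsKG : K <| G by rewrite gFnormal_trans.
  have nKG := normal_norm nsKG; have nKN := subset_trans sNG nKG.
  have nKW := subset_trans sWG nKG.
  have crN : central_rank_le r N Z := central_rank_le_sub crG sNG (joing_subr V Z).
  have nsKN : K <| N.
    rewrite /normal nKN andbT -[gval K]/('Mho^1(W)) gFsub_trans //.
    by rewrite (subset_trans sWV) ?joing_subl.
  have crB := central_rank_le_quotient crN nsKN.
  pose B := (N / K)%G.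
  have pB : p.-group B := quotient_pgroup K (pgroupS sNG pG).
  have defB' : B^`(1) = W / K by rewrite -quotient_der // defW.
  have abelB' : p.-abelem (B^`(1)).
    rewrite defB' /quotient; apply/abelemP => //; split.
      by apply: sub_der1_abelian; apply: subset_trans powW (Mho_sub 1 _).
    move=> _ /morphimP[x Nx Wx ->]; rewrite -morphX //.
    exact/coset_id/(mem_Mho1 pW).
  have cB' : B^`(1) \subset 'Z(B).
    rewrite subsetI der_sub defB' quotient_cents2 //.
    rewrite (subset_trans _ (Mho_sub 1 _)) // (subset_trans _ sWV2) //.
    rewrite commGC /N /= (cent_joinEr cZV) commMG; last first.
      by rewrite cents_norm // (subset_trans cZG) // centS // comm_subG.
    rewrite (commG1P (subset_trans cZG (centS sWG))) mulg1 commGC.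
    exact: subxx.
  have sPhiZ : 'Phi(B) \subset 'Z(B).
    rewrite subsetI Phi_sub; apply/commG1P/trivgP.
    apply: subset_trans (commg_Phi_sub pB _ _ cB' _) _ => //.
    apply: (Mho1_sub (K := 1%G) (abelem_pgroup abelB')) => x B'x.
    by rewrite inE; case/(abelemP p_pr): abelB' => _ ->.
  have sZB : Z / K \subset 'Z(B) by case: crB.
  have := card_abelem_der1_index p_pr pB crB sZB (center_sub B) (der_sub 1 B) abelB'.
  rewrite setIid (derG1P (center_abelian B)) (setIidPr (sub1G _)) cards1 mul1n.
  have -> : #|B^`(1)%G| = #|W : K| by rewrite /= defB' card_quotient.
  move=> leWK; apply: leq_trans leWK _.
  rewrite expnM leX //.
  (* The factor 1 counts a single Frattini step, ['Phi(B)] being central. *)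
  rewrite -(muln1 r); apply: (central_rank_le_index p_pr pB crB) => //.
  exact: center_sub.
have := card_abelem_der1_index p_pr pG crG (joing_subr V Z) sNG sEG abelE.
rewrite (setIidPl sEG') defW => leE; apply: (leq_trans leE).
by rewrite expnD leq_mul ?(leq_trans leEW leW) // expnM leX.
Qed.

(** * Transfer into a Sylow subgroup *)

(** The transfer from [G] to P / P' kills G', and sends an element [z] of [P] central in [G] to its
    coset raised to the power |G : P|. That index is prime to [p], so the coset is trivial. *)
Lemma central_focal_subgroup (gT : finGroupType) (p : nat) (G P : {group gT}) :
  p.-Sylow(G) P -> P :&: 'Z(G) :&: G^`(1) \subset P^`(1).
Proof.
move=> sylP; have [sPG pP p'i] := and3P sylP.
have nP'P : P \subset 'N(P^`(1)) := der_norm 1 P.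
pose f := restrm_morphism nP'P (coset_morphism P^`(1)).
have abP : abelian (f @* P) by rewrite morphim_restrm setIid sub_der1_abelian.
apply/subsetP=> z /setIP[/setIP[Pz Zz] G'z].
have Gz := subsetP sPG z Pz.
have /setIP[_ /centP cz] := Zz.
have Vz0 : transfer G abP z = 0%R.
  apply: (mker (f := transfer_morphism G abP)); apply: (subsetP _ z G'z).
  rewrite ker_trivg_morphim der_sub morphim_der //= subG1.
  by apply/eqP/derG1P/FinRing.zmod_abelian.
have Vz : transfer G abP z = (FiniteModule.fmod abP (f z) *+ #|G : P|)%R.
  rewrite /transfer -GRing.sumr_const; apply: eq_bigr => Px /rcosetsP[x Gx def_Px].
  have -> : Px :* z = Px.
    rewrite def_Px -rcosetM -cz // rcosetM; congr (_ :* _).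
    by rewrite rcoset_id.
  have Gr : repr Px \in G.
    rewrite def_Px; case: repr_rcosetP => y Py.
    exact: groupM (subsetP sPG y Py) Gx.
  by rewrite -cz // mulgK.
have fz1 : coset P^`(1) z ^+ #|G : P| = 1.
  have := congr1 val Vz; rewrite Vz0 FiniteModule.fmvalZ FiniteModule.fmodK //.
  by rewrite mem_morphim.
have Nz : z \in 'N(P^`(1)) := subsetP nP'P z Pz.
apply: coset_idr => //; apply/eqP; rewrite -order_eq1 -dvdn1.
move/eqP: fz1; rewrite -order_dvdn => dv_zn.
have p_cz : p.-elt (coset P^`(1) z) by rewrite morph_p_elt ?(mem_p_elt pP).
have /eqP co_zn := pnat_coprime p_cz p'i.
have := dvdn_gcd #[coset P^`(1) z] #[coset P^`(1) z] #|G : P|.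
by rewrite co_zn dvdnn dv_zn.
Qed.

(** * The rank of the derived subgroup *)

Lemma prank_leq (gT : finGroupType) (K : {set gT}) (n : nat) :
  (prank K <= n) = has_rank K n.
Proof.
rewrite /prank; case: ex_minnP => m rkm minm; apply/idP/idP; last exact: minm.
move=> le_mn; apply/forall_inP=> H sHK.
by apply: leq_trans le_mn; apply: (forall_inP rkm).
Qed.

Theorem theorem1 :
  exists f : nat -> nat,
    forall (gT : finGroupType) (G : {group gT}) (r : nat),
      prank (G / 'Z(G)) = r -> prank G^`(1) <= f r.
Proof.
(* The first [r] counts generators of [H / 'Z(G)]; the rest is the exponent in [card_abelem_der1],
   which bounds those of [H :&: 'Z(G)]. *)
exists (fun r => r + (r * r + r * (r * 2).+2 * r)) => gT G r rkG.
have {}rkG (H : {group gT}) : H \subset G -> 'm(H / 'Z(G)) <= r.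
  move=> sHG; have := leqnn (prank (G / 'Z(G))).
  rewrite {2}rkG prank_leq => /forall_inP/(_ (H / 'Z(G))%G).
  by apply; apply: quotientS.
rewrite prank_leq; apply/forall_inP=> H sHG'.
have sHG := subset_trans sHG' (der_sub 1 G).
have nZG : G \subset 'N('Z(G)) := normal_norm (center_normal G).
apply: leq_trans (grank_extension (subset_trans sHG nZG)) _.
rewrite leq_add ?rkG //.
have cHZ : abelian (H :&: 'Z(G)) := abelianS (subsetIr _ _) (center_abelian G).
rewrite grank_abelian //; have [p p_pr ->] := rank_witness (H :&: 'Z(G))%G.
have [E /pnElemP[sEHZ abelE <-]] := p_rank_witness p (H :&: 'Z(G))%G.
move: sEHZ; rewrite subsetI => /andP[sEH sEZ].
have sEG := subset_trans sEH sHG.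
have [P sylP sEP] := Sylow_superset sEG (abelem_pgroup abelE).
have [sPG pP _] := and3P sylP.
have sEP' : E \subset P^`(1).
  apply: subset_trans (central_focal_subgroup sylP).
  by rewrite subsetI (subset_trans sEH sHG') andbT subsetI sEP.
have crP : central_rank_le r P (P :&: 'Z(G)).
  split; first by rewrite setIS // (subset_trans (subsetIr _ _)) ?centS.
  move=> K sKP; have sKG := subset_trans sKP sPG.
  apply: leq_trans (rkG K sKG).
  have nZK := subset_trans sKG nZG.
  (* As [K] lies in [P], both quotients are isomorphic to that of [K] by [K :&: 'Z(G)]. *)
  have /isog_grank <- := second_isog nZK.
  have nPZ : K \subset 'N(P :&: 'Z(G)).
    exact: normsI (subset_trans sKP (normG P)) nZK.
  have /isog_grank <- := second_isog nPZ.
  by rewrite /= setIAC (setIidPr sKP) setIC.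
have := card_abelem_der1 p_pr pP crP sEP' abelE.
by rewrite {1}(card_pgroup (abelem_pgroup abelE)) leq_exp2l ?prime_gt1.
Qed.
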